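(* Let $R$ be an integral domain, let $F,G\in R[x]$ be polynomials of degrees $m$ and $n$ respectively with $m>n>0$, and let $(P_1^{(1)},\ldots,P_{l_1}^{(1)},\ldots,P_1^{(t)},\ldots,P_{l_t}^{(t)})$ be a complete recursive polynomial remainder sequence for $F$ and $G$. Put $j_0=m$ and $j_k=\deg P_{l_k}^{(k)}$ for $k=1,\ldots,t$. For $k=2,\ldots,t$ and $j=j_{k-1}-2,\ldots,0$ (and also for $j=j_k$) define $$u_{k,j}=(m+n-2j_1)\Big\{\prod_{l=2}^{k-1}(2j_{l-1}-2j_l-1)\Big\}(2j_{k-1}-2j-1),\qquad u_k=u_{k,j_k},\qquad u_1=m+n-2j_1,$$ $$b_{k,j}=2j_{k-1}-2j-1,\qquad b_k=b_{k,j_k},\qquad b_1=1,$$ $$r_{k,j}=(-1)^{(u_{k-1}-1)(1+2+\cdots+(b_{k,j}-1))},\qquad r_k=r_{k,j_k},\qquad r_{1,j}=1\ \text{ for } j<n,$$ $$R_k=(R_{k-1})^{b_k}\,r_k\quad (k\ge 2),\qquad R_0=R_1=1.$$ Then, for all $k=2,\ldots,t$ and all $j=j_{k-1}-2,\ldots,0$, the $(k,j)$-th nested subresultant $\tilde{S}_{k,j}(F,G)$ and the $(k,j)$-th recursive subresultant $\bar{S}_{k,j}(F,G)$ of $F$ and $G$ satisfy $$\tilde{S}_{k,j}(F,G)=(R_{k-1})^{b_{k,j}}\; r_{k,j}\;\bar{S}_{k,j}(F,G).$$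
   Context: Throughout, $R$ is an integral domain with quotient field $K$, and $|M|$ denotes the determinant of a square matrix $M$. **PRS.** For polynomials $F,G\in R[x]$ of degrees $m>n$, a sequence $(P_1,\ldots,P_l)$ of nonzero polynomials in $R[x]$ is a polynomial remainder sequence (PRS) for $F$ and $G$ if $P_1=F$, $P_2=G$, and $\alpha_iP_{i-2}=q_{i-1}P_{i-1}+\beta_iP_i$ for $i=3,\ldots,l$, with $\alpha_i,\beta_i\in R$, polynomials $q_{i-1}$, and $\deg P_{i-1}>\deg P_i$. **Recursive PRS.** A sequence $(P_1^{(1)},\ldots,P_{l_1}^{(1)},P_1^{(2)},\ldots,P_{l_2}^{(2)},\ldots,P_1^{(t)},\ldots,P_{l_t}^{(t)})$ of nonzero polynomials is a recursive PRS for $F$ and $G$ if: $P_1^{(1)}=F$, $P_2^{(1)}=G$; for $k=2,\ldots,t$, $P_1^{(k)}=P_{l_{k-1}}^{(k-1)}$ and $P_2^{(k)}=\frac{d}{dx}P_{l_{k-1}}^{(k-1)}$; and for every $k=1,\ldots,t$, $(P_1^{(k)},\ldots,P_{l_k}^{(k)})$ is a PRS for $P_1^{(k)}$ and $P_2^{(k)}$ with $P_{l_k}^{(k)}=\gamma_k\cdot\gcd(P_1^{(k)},P_2^{(k)})$ for some $\gamma_k\in R$. It is complete if $P_{l_t}^{(t)}$ is a constant. Put $j_0=m$ and $j_k=\deg P_{l_k}^{(k)}$. **Subresultant matrix.** Let $A=\sum_{i=0}^{p}a_ix^i$ and $B=\sum_{i=0}^{q}b_ix^i$ be polynomials regarded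 as having nominal degrees $p>q\ge 0$ (leading coefficients may vanish), and let $0\le j\le q$. $N^{(j)}(A,B)$ is the $(p+q-j)\times(p+q-2j)$ matrix whose column $c$ ($1\le c\le q-j$) has entry $a_{p-(r-c)}$ in row $r$, and whose column $q-j+c$ ($1\le c\le p-j$) has entry $b_{q-(r-c)}$ in row $r$, with entries of out-of-range index equal to $0$. (So it consists of $q-j$ successively down-shifted coefficient columns of $A$ followed by $p-j$ successively down-shifted coefficient columns of $B$, both groups starting at the top row.) The pair $F,G$ has nominal degrees $m,n$; if $S$ is a polynomial written with nominal degree $d$, then $\frac{d}{dx}S$ has nominal degree $d-1$. The matrices below are defined for $k=1$ and $0\le j\le n$, and for $2\le k\le t$ and $0\le j\le j_{k-1}-1$. **Recursive subresultant matrix** $\bar N^{(k,j)}=\bar N^{(k,j)}(F,G)$. For $k=1$, $\bar N^{(1,j)}=N^{(j)}(F,G)$. For $k>1$, let $\bar N_U^{(k-1,j_{k-1})}$ be $\bar N^{(k-1,j_{k-1})}$ with its bottom $j_{k-1}+1$ rows deleted, let $\bar N_L^{(k-1,j_{k-1})}$ consist of those bottom $j_{k-1}+1$ rows, and let $\bar N_L'^{(k-1,j_{k-1})}$ be obtained from $\bar N_L^{(k-1,j_{k-1})}$ by multiplying its $(j_{k-1}+1-\tau)$-th row by $\tau$ for $\tau=j_{k-1},\ldots,1$ and then deleting its bottom row. Then $\bar N^{(k,j)}$ consists of an upper block on top of a lower block: - the upper block is block diagonal, partitioned into $(2j_{k-1}-2j-1)\times(2j_{k-1}-2j-1)$ blocks,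 with every diagonal block equal to $\bar N_U^{(k-1,j_{k-1})}$ and zeros elsewhere; - the lower block has $2j_{k-1}-j-1$ rows and, from left to right, $2j_{k-1}-2j-1$ column blocks (aligned with those of the upper block): first $j_{k-1}-j-1$ copies of $\bar N_L^{(k-1,j_{k-1})}$, the leftmost placed at the top row of the lower block and each next copy placed one row lower than the preceding one; then $j_{k-1}-j$ copies of $\bar N_L'^{(k-1,j_{k-1})}$, again the first placed at the top row of the lower block and each next one placed one row lower; all other entries are zero. For $k\ge2$ the matrix $\bar N^{(k,j)}$ has $u_{k,j}$ columns and $u_{k,j}+j$ rows, with $u_{k,j}$ as in the claim. **Recursive subresultant.** For $k\ge 2$ and $\tau=j,\ldots,0$, $\bar N_\tau^{(k,j)}$ is the square matrix formed by the top $u_{k,j}-1$ rows and the $(u_{k,j}+j-\tau)$-th row of $\bar N^{(k,j)}$. The $(k,j)$-th recursive subresultant is $\bar S_{k,j}(F,G)=|\bar N_j^{(k,j)}|x^j+\cdots+|\bar N_0^{(k,j)}|x^0$. **Nested subresultant matrix and nested subresultant.** Defined recursively by $\tilde N^{(1,j)}(F,G)=N^{(j)}(F,G)$ and, for $k>1$, $$\tilde N^{(k,j)}(F,G)=N^{(j)}\Big(\tilde S_{k-1,j_{k-1}}(F,G),\ \tfrac{d}{dx}\tilde S_{k-1,j_{k-1}}(F,G)\Big),$$ where $\tilde S_{k-1,j_{k-1}}$ has nominal degree $j_{k-1}$. Put $C_{1,j}=m+n-2j$ and $C_{k,j}=2j_{k-1}-2j-1$ for $k\ge2$ (the number of columns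 of $\tilde N^{(k,j)}$). For $\tau=j,\ldots,0$, $\tilde N_\tau^{(k,j)}$ is the square matrix formed by the top $C_{k,j}-1$ rows and the $(C_{k,j}+j-\tau)$-th row of $\tilde N^{(k,j)}$, and the $(k,j)$-th nested subresultant is $\tilde S_{k,j}(F,G)=|\tilde N_j^{(k,j)}|x^j+\cdots+|\tilde N_0^{(k,j)}|x^0$. *)

(* Defs.v *)
From mathcomp Require Import all_boot all_order all_algebra.

Set Implicit Arguments.
Unset Strict Implicit.
Unset Printing Implicit Defensive.

Import GRing.Theory.
Local Open Scope ring_scope.

(* The list [:: P_1; ...; P_l] is 0-indexed: P_i is s`_(i - 1). *)
Definition is_prs (R : idomainType) (F G : {poly R}) (s : seq {poly R}) : Prop :=
  [/\ (1 < size s)%N /\ (forall p, p \in s -> p != 0),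
      s`_0 = F /\ s`_1 = G,
      (forall i, (i.+2 < size s)%N ->
         exists (alpha beta : R) (q : {poly R}),
           alpha *: s`_i = q * s`_i.+1 + beta *: s`_i.+2)
    & (forall i, (i.+1 < size s)%N -> (size (s`_i.+1)%R < size (s`_i)%R)%N)].

(* A gcd of A and B, up to constants of the quotient field: over an integral
   domain, divisibility (and hence gcdp and %=) is that of K[x]. *)
Definition is_gcd (R : idomainType) (A B g : {poly R}) : Prop := g %= gcdp A B.

(* (P_1^(k), ..., P_{l_k}^(k)), for k >= 1. *)
Definition rprs_block (R : idomainType) (P : seq (seq {poly R})) (k : nat) :
  seq {poly R} := nth [::] P k.-1.

Definition rprs_last (R : idomainType) (P : seq (seq {poly R})) (k : nat) :
  {poly R} := last 0 (rprs_block P k).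

Definition is_recursive_prs (R : idomainType) (F G : {poly R})
    (P : seq (seq {poly R})) : Prop :=
  [/\ (0 < size P)%N,
      (rprs_block P 1)`_0 = F /\ (rprs_block P 1)`_1 = G,
      (forall k, (1 < k <= size P)%N ->
         (rprs_block P k)`_0 = rprs_last P k.-1 /\
         (rprs_block P k)`_1 = (rprs_last P k.-1)^`())
    & (forall k, (0 < k <= size P)%N ->
         is_prs (rprs_block P k)`_0 (rprs_block P k)`_1 (rprs_block P k) /\
         exists (gamma : R) (g : {poly R}),
           is_gcd (rprs_block P k)`_0 (rprs_block P k)`_1 g /\
           rprs_last P k = gamma *: g)].

Definition rprs_complete (R : idomainType) (P : seq (seq {poly R})) : Prop :=
  (size (rprs_last P (size P)) <= 1)%N.

(* j_k *)
Definition rprs_deg (R : idomainType) (m : nat) (P : seq (seq {poly R}))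
    (k : nat) : nat :=
  if k is 0 then m else (size (rprs_last P k)).-1.

Definition mxnth (R : idomainType) (a b : nat) (M : 'M[R]_(a, b)) (r c : nat) : R :=
  if insub r is Some i then if insub c is Some l then M i l else 0 else 0.

(* Entry in row r of the coefficient column of A, of nominal degree p, shifted
   down by c rows. *)
Definition shifted_coef (R : idomainType) (p : nat) (A : {poly R}) (c r : nat) : R :=
  if (c <= r <= p + c)%N then A`_(p + c - r) else 0.

(* N^(j)(A, B), of nominal degrees p and q. For j <= q the number of rows
   (p + q - 2j) + j is p + q - j; all the matrices below have C columns and
   C + j rows. *)
Definition subres_mx (R : idomainType) (p q j : nat) (A B : {poly R}) :
  'M[R]_((p + q - 2 * j) + j, p + q - 2 * j) :=
  \matrix_(r, c) if (c < q - j)%N then shifted_coef p A c r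
                 else shifted_coef q B (c - (q - j)) r.

(* The top C - 1 rows and the (C + j - tau)-th row (counted from 1). *)
Definition select_mx (R : idomainType) (C j : nat) (M : 'M[R]_(C + j, C))
    (tau : nat) : 'M[R]_C :=
  \matrix_(i, l) mxnth M (if (i < C.-1)%N then nat_of_ord i else (C + j - tau).-1) l.

Definition minor_poly (R : idomainType) (C j : nat) (M : 'M[R]_(C + j, C)) :
  {poly R} := \poly_(tau < j.+1) \det (select_mx M tau).

(* Below, J plays the role of k |-> j_k. The subtractions of natural numbers do
   not truncate when J is strictly decreasing, J 1 <= n < m and j < J k.-1.
   The indices k start at 1 (at 0 in R_k). *)

(* b_(k,j) *)
Definition bexp (J : nat -> nat) (k j : nat) : nat :=
  (if k is _.+2 then 2 * J k.-1 - 2 * j - 1 else 1)%N.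

(* u_(k,j), with u_(1,j) = m + n - 2j, so that u_k is u_(k,j_k) for k = 1 too. *)
Definition ucols (m n : nat) (J : nat -> nat) (k j : nat) : nat :=
  (if k is _.+2 then
     (m + n - 2 * J 1) * (\prod_(2 <= l < k) (2 * J l.-1 - 2 * J l - 1))
       * (2 * J k.-1 - 2 * j - 1)
   else m + n - 2 * j)%N.

Definition upper_mx (R : idomainType) (u d : nat) (M : 'M[R]_(u + d, u)) :
  'M[R]_(u.-1, u) := \matrix_(r, c) mxnth M r c.

Definition lower_mx (R : idomainType) (u d : nat) (M : 'M[R]_(u + d, u)) :
  'M[R]_(d.+1, u) := \matrix_(r, c) mxnth M (u.-1 + r) c.

Definition lower_deriv_mx (R : idomainType) (u d : nat) (M : 'M[R]_(u + d, u)) :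
  'M[R]_(d, u) := \matrix_(r, c) (mxnth (lower_mx M) r c *+ (d - r)).

(* Entry in row s of the column c of M, shifted down by i rows. *)
Definition shifted_entry (R : idomainType) (a b : nat) (M : 'M[R]_(a, b))
    (i s c : nat) : R :=
  if (i <= s)%N then mxnth M (s - i) c else 0.

(* The construction of the (k,j)-th recursive subresultant matrix from the
   matrix M of index (k-1, d), d = j_(k-1), with u columns. Column c is in the
   column block c %/ u, and the upper block has u.-1 * (2d - 2j - 1) rows. *)
Definition recursive_step (R : idomainType) (u d j C : nat)
    (M : 'M[R]_(u + d, u)) : 'M[R]_(C + j, C) :=
  let h := (u.-1 * (2 * d - 2 * j - 1))%N in
  let e := (d - j - 1)%N in
  \matrix_(r, c)
    let i := (c %/ u)%N in
    if (r < h)%N then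
      if (r %/ u.-1 == i)%N then mxnth (upper_mx M) (r %% u.-1) (c %% u) else 0
    else if (i < e)%N then shifted_entry (lower_mx M) i (r - h) (c %% u)
    else shifted_entry (lower_deriv_mx M) (i - e) (r - h) (c %% u).

(* The matrix of index (k+1, j), for k >= 0. *)
Fixpoint recursive_subres_mxS (R : idomainType) (m n : nat) (J : nat -> nat)
    (F G : {poly R}) (k j : nat) {struct k} :
    'M[R]_(ucols m n J k.+1 j + j, ucols m n J k.+1 j) :=
  match k return 'M[R]_(ucols m n J k.+1 j + j, ucols m n J k.+1 j) with
  | 0 => subres_mx m n j F G
  | k'.+1 =>
      recursive_step j (ucols m n J k'.+2 j)
        (recursive_subres_mxS m n J F G k' (J k'.+1))
  end.

Definition recursive_subres (R : idomainType) (m n : nat) (J : nat -> nat)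
    (F G : {poly R}) (k j : nat) : {poly R} :=
  minor_poly (recursive_subres_mxS m n J F G k.-1 j).

(* C_(k,j), which is 2 j_(k-1) - 2j - 1 for k >= 2. *)
Definition nested_cols (m n : nat) (J : nat -> nat) (k j : nat) : nat :=
  (if k is _.+2 then J k.-1 + (J k.-1).-1 - 2 * j else m + n - 2 * j)%N.

(* The matrix of index (k+1, j), for k >= 0. *)
Fixpoint nested_subres_mxS (R : idomainType) (m n : nat) (J : nat -> nat)
    (F G : {poly R}) (k j : nat) {struct k} :
    'M[R]_(nested_cols m n J k.+1 j + j, nested_cols m n J k.+1 j) :=
  match k return
    'M[R]_(nested_cols m n J k.+1 j + j, nested_cols m n J k.+1 j) with
  | 0 => subres_mx m n j F G
  | k'.+1 =>
      let S := minor_poly (nested_subres_mxS m n J F G k' (J k'.+1)) in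
      subres_mx (J k'.+1) (J k'.+1).-1 j S S^`()
  end.

Definition nested_subres (R : idomainType) (m n : nat) (J : nat -> nat)
    (F G : {poly R}) (k j : nat) : {poly R} :=
  minor_poly (nested_subres_mxS m n J F G k.-1 j).

(* r_(k,j) *)
Definition rsign (R : idomainType) (m n : nat) (J : nat -> nat) (k j : nat) : R :=
  if k is _.+2 then
    (-1) ^+ ((ucols m n J k.-1 (J k.-1) - 1) * \sum_(1 <= i < bexp J k j) i)%N
  else 1.

(* R_k *)
Fixpoint Rcoef (R : idomainType) (m n : nat) (J : nat -> nat) (k : nat) : R :=
  match k with
  | k1.+1 =>
      if k1 is 0 then 1
      else Rcoef R m n J k1 ^+ bexp J k (J k) * rsign R m n J k (J k)
  | 0 => 1
  end.

(* Main.v *)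
Require Import Defs.
From mathcomp Require Import all_boot all_order all_algebra.
From mathcomp Require Import zify.
Import GRing.Theory.
Local Open Scope ring_scope.

(** The recursive subresultant matrix of level [k] carries the whole matrix of
level [k - 1] inside it: with [V] the upper part of that matrix, of size
[v * (v + 1)], its square submatrices have the shape
[[
   V
       V
           ...
               V
   W_00 W_01 ... W_0(b-1)
   ...
]]
with [b] diagonal copies of [V] above [b] rows, each cut into [b] row vectors
[W_ic] of length [v + 1].  The theorem rests on one identity for such matrices,
[det_diag_blocks]: up to the sign [(-1) ^ (v * (1 + ... + (b - 1)))], the
determinant is the [b * b] determinant whose entries are the determinants of
[V] bordered by [W_ic] as last row.  (Bring row [i] of the lower part just below
the [i]-th copy of [V]: this costs exactly that sign.  Since multiples of the
rows of [V] may be added to each [W_ic], only its class modulo the row space of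
[V] matters; when [V] has full rank the quotient is a line, on which the
bordered determinant is a coordinate, and otherwise both sides vanish if
[b > 0].)

In the recursive subresultant matrix the [W_ic] are rows of the lower part [L]
of the previous matrix, or multiples of them.  Bordering [V] by a row of [L]
gives by definition a coefficient of the recursive subresultant [S] of the
previous level, and the multiplied rows give coefficients of [S^`()].  So the
bordered determinants are exactly the entries of the subresultant matrix of [S]
and [S^`()] ([minor_poly_recursive_step]).

Hence the recursive subresultants satisfy the same recurrence as the nested
ones, up to the sign [rsign].  If the nested subresultant of level [k - 1] is
[a] times the recursive one, homogeneity in the two polynomials
([minor_poly_subres_scale]) turns [a] into its power of exponent the number of
columns; this is the recurrence that defines [Rcoef], and induction on [k]
concludes.  In a recursive polynomial remainder sequence the degrees [j_k]
strictly decrease from [j_1 <= n] on ([size_prs_last]), so that all these blocks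
have positive sizes and every difference of degrees is a true one. *)

(** * Eliminating a block with one column more than rows *)

(** Square matrices whose entries are functions of natural numbers: their size
can be rewritten along equations such as [b.+1 * v.+1 = v + (b * v.+1).+1]
without casts. *)
Definition sqmx {R : idomainType} (N : nat) (f : nat -> nat -> R) : 'M[R]_N :=
  \matrix_(i, c) f i c.

Lemma eq_det_sqmx (R : idomainType) (N : nat) (f g : nat -> nat -> R) :
  (forall i c, (i < N)%N -> (c < N)%N -> f i c = g i c) ->
  \det (sqmx N f) = \det (sqmx N g).
Proof.
move=> fg; congr (\det _); apply/matrixP=> i c; rewrite !mxE; exact: fg.
Qed.

(** The right factor [T] of the proof is column elimination with the adjugate in
place of the inverse: it clears [B] at the price of a factor [\det A]. *)
Lemma det_block_border_regular (R : idomainType) (v q : nat) (A : 'M[R]_v)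
    (B : 'cV[R]_v) (C : 'M[R]_(1 + q, v)) (p : 'cV[R]_(1 + q))
    (Q : 'M[R]_(1 + q, q)) :
  \det A != 0 ->
  \det (block_mx A (row_mx B 0) C (row_mx p Q)) =
  \det (row_mx (\det A *: p - C *m (\adj A *m B)) Q).
Proof.
move=> A0; apply: (mulIf A0).
pose T : 'M[R]_(v + (1 + q)) :=
  block_mx 1%:M (row_mx (- (\adj A *m B)) 0) 0 (block_mx (\det A)%:M 0 0 1%:M).
have <- : \det T = \det A.
  by rewrite det_ublock det1 mul1r det_ublock det1 mulr1 det_scalar expr1.
rewrite -det_mulmx /T mulmx_block !mulmx1 !mulmx0 !addr0.
rewrite !mul_mx_row !mulmx0 !mul_row_block !mulmx0 !mul0mx !mulmx1 !add0r !addr0.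
rewrite !add_row_mx !addr0 !add0r mulmxN mulmxA mul_mx_adj mul_scalar_mx.
rewrite mul_mx_scalar addNr row_mx0 det_lblock mulrC -!mul_mx_scalar.
rewrite det_ublock det1 mul1r det_ublock det1 mulr1 det_scalar expr1.
by congr (\det (row_mx _ _) * _); rewrite mulmxN addrC.
Qed.

(** Both sides are polynomials in the entries of [A], so the case of a singular
[A] follows from the regular case for [A + 'X], whose determinant is a monic
polynomial, by evaluation at 0. *)
Lemma det_block_border (R : idomainType) (v q : nat) (A : 'M[R]_v)
    (B : 'cV[R]_v) (C : 'M[R]_(1 + q, v)) (p : 'cV[R]_(1 + q))
    (Q : 'M[R]_(1 + q, q)) :
  \det (block_mx A (row_mx B 0) C (row_mx p Q)) =
  \det (row_mx (\det A *: p - C *m (\adj A *m B)) Q).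
Proof.
pose AX : 'M[{poly R}]_v := char_poly_mx (- A).
have AX0 : \det AX != 0 by apply: monic_neq0; exact: char_poly_monic.
have AXA : map_mx (horner_eval 0) AX = A.
  apply/matrixP=> i c.
  by rewrite !mxE /horner_eval !hornerE hornerMn hornerX mul0rn sub0r opprK.
have evC a b (D : 'M[R]_(a, b)) : map_mx (horner_eval 0) (map_mx polyC D) = D.
  by apply/matrixP=> i c; rewrite !mxE /horner_eval hornerC.
have := congr1 (horner_eval (0 : R)) (@det_block_border_regular _ v q AX
  (map_mx polyC B) (map_mx polyC C) (map_mx polyC p) (map_mx polyC Q) AX0).
rewrite -!det_map_mx map_block_mx !map_row_mx map_mx0 !evC AXA.
rewrite map_mxB map_mxZ !map_mxM map_mx_adj -det_map_mx !evC AXA.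
by [].
Qed.

(** The vector [\det A *: p - C *m (\adj A *m B)] of [det_block_border] consists
of bordered determinants: its [i]-th entry is given by the same formula applied
to the matrix whose only lower row is row [i]. *)
Lemma det_sqmx_border (R : idomainType) (v q : nat) (f : nat -> nat -> R) :
  (forall r c, (r < v)%N -> (v < c < v + q.+1)%N -> f r c = 0) ->
  \det (sqmx (v + q.+1) f) =
  \det (sqmx q.+1 (fun i c =>
     if c == 0%N
     then \det (sqmx v.+1 (fun r l => f (if (r < v)%N then r else v + i)%N l))
     else f (v + i)%N (v + c)%N)).
Proof.
move=> f0.
pose A : 'M[R]_v := \matrix_(r, c) f r c.
pose B : 'cV[R]_v := \col_r f r v.
pose C : 'M[R]_(1 + q, v) := \matrix_(i, c) f (v + i)%N c.
pose p : 'cV[R]_(1 + q) := \col_i f (v + i)%N v.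
pose Q : 'M[R]_(1 + q, q) := \matrix_(i, c) f (v + i)%N (v + 1 + c)%N.
have E : \det (sqmx (v + (1 + q)) f) =
         \det (block_mx A (row_mx B 0) C (row_mx p Q)).
  congr (\det _); apply/matrixP=> r c; rewrite !mxE.
  case: (splitP r) => i ri; rewrite !mxE; case: (splitP c) => l cl;
  rewrite !mxE ?ri ?cl //;
  case: (splitP l) => l' ll; rewrite !mxE ll ?(ord1 l') ?addn0 ?addnA //.
  by apply: f0; rewrite ?ltn_ord //; have := ltn_ord l'; lia.
rewrite -[q.+1]/(1 + q)%N E det_block_border.
congr (\det _); apply/matrixP=> i c; rewrite !mxE.
case: (splitP c) => l cl; last first.
  by rewrite cl !mxE /= addnA.
rewrite (ord1 l) in cl *; rewrite cl /=.
pose Ci : 'M[R]_(1 + 0, v) := row i C.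
pose pi : 'cV[R]_(1 + 0) := const_mx (p i 0).
rewrite -(addn1 v).
have -> : \det (sqmx (v + 1) (fun r l => f (if (r < v)%N then r else v + i)%N l))
   = \det (block_mx A (row_mx B 0) Ci (row_mx pi (0 : 'M_(1 + 0, 0)))).
  congr (\det _); apply/matrixP=> r c'; rewrite !mxE.
  case: (splitP r) => i' ri; rewrite !mxE; case: (splitP c') => l' cl';
  rewrite !mxE ?ri ?cl' ?ltn_ord ?ltnNge ?leq_addr //=;
  case: (@splitP 1 0 l') => l'' ll; rewrite ?mxE ?ll ?(ord1 l'') ?addn0 ?addnA //;
  by case: l'' ll.
rewrite det_block_border det_mx11 !mxE.
case: (@splitP 1 0 0) => l' /= ll; last by have := ltn_ord l'; lia.
rewrite (ord1 l') !mxE; congr (_ - _).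
by apply: eq_bigr => t _; rewrite !mxE.
Qed.

(** * The determinant of a block diagonal matrix above full rows *)

Lemma expand_det_sqmx_col0 (R : idomainType) (N : nat) (f : nat -> nat -> R) :
  \det (sqmx N.+1 f) =
  \sum_(0 <= i < N.+1)
    f i 0%N * ((-1) ^+ i * \det (sqmx N (fun r c => f (bump i r) c.+1))).
Proof.
rewrite (expand_det_col _ ord0) big_mkord; apply: eq_bigr => i _.
rewrite mxE /cofactor addn0; congr (_ * (_ * \det _)).
by apply/matrixP=> r c; rewrite !mxE.
Qed.

Definition bordered_det {R : idomainType} (v : nat) (V : nat -> nat -> R)
    (w : nat -> R) : R :=
  \det (sqmx v.+1 (fun r l => if (r < v)%N then V r l else w l)).

Lemma bordered_det0 (R : idomainType) (v : nat) (V : nat -> nat -> R)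
    (w : nat -> R) :
  (forall l, (l <= v)%N -> w l = 0) -> bordered_det v V w = 0.
Proof.
move=> w0; rewrite /bordered_det (expand_det_row _ ord_max) big1 // => l _.
by rewrite mxE /= ltnn w0 ?mul0r // -ltnS.
Qed.

(** By induction on [b].  Eliminating the first copy of [V] leaves the other
copies, on top of the lower rows, behind a first column that is zero on those
copies and holds the bordered determinants of [W i 0] below.  Expanding along
that column moves it across [v * b] rows, whence the sign. *)
Lemma det_diag_blocks (R : idomainType) (v b : nat) (V : nat -> nat -> R)
    (W : nat -> nat -> nat -> R) :
  \det (sqmx (b * v.+1) (fun r c =>
     if (r < v * b)%N
     then if (r %/ v == c %/ v.+1)%N then V (r %% v)%N (c %% v.+1)%N else 0
     else W (r - v * b)%N (c %/ v.+1)%N (c %% v.+1)%N)) =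
  (-1) ^+ (v * \sum_(1 <= i < b) i)
    * \det (sqmx b (fun i c => bordered_det v V (W i c))).
Proof.
elim: b W => [|b IHb] W.
  by rewrite big_geq // muln0 expr0 mul1r !det_mx00.
have -> : (b.+1 * v.+1 = v + (b * v.+1).+1)%N by rewrite mulSn addSnnS.
rewrite det_sqmx_border; last first.
  move=> r c rv /andP[vc cb]; have v0 : (0 < v)%N by apply: leq_ltn_trans rv.
  have -> : (r < v * b.+1)%N by rewrite mulnS ltn_addr.
  rewrite divn_small //; case: eqP => // c0.
  by move: vc; rewrite ltnNge -ltnS ltnNge -(divn_gt0 c (ltn0Sn v)) -c0.
rewrite !expand_det_sqmx_col0 /=.
have Nb : (b * v.+1 = v * b + b)%N by rewrite mulnS addnC mulnC.
(* The first [v * b] terms come from the remaining copies of [V]. *)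
rewrite [X in index_iota 0 X](_ : _ = (v * b + b.+1)%N); last by rewrite Nb addnS.
rewrite (big_cat_nat _ (n := (v * b)%N)) ?leq_addr //=.
rewrite big1_seq ?add0r; last first.
  move=> i /andP[_]; rewrite mem_index_iota => /andP[_ ib].
  have v0 : (0 < v)%N by case: v ib {IHb Nb}.
  rewrite [X in X * _](_ : _ = 0) ?mul0r //.
  rewrite (@eq_det_sqmx R v.+1 _ (fun r l => if (r < v)%N then V r l else 0)).
    exact: bordered_det0.
  move=> r l rv lv; rewrite [(l %/ _)%N]divn_small // [(l %% _)%N]modn_small //.
  case: (ltnP r v) => [rv'|_].
    by rewrite mulnS ltn_addr // divn_small // modn_small.
  by rewrite mulnS ltn_add2l ib divnDl // divnn v0.
rewrite -{1}[(v * b)%N]add0n big_addn addKn big_distrr /=.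
apply: eq_big_nat => i /andP[_ ib].
have -> : (\sum_(1 <= l < b.+1) l = \sum_(1 <= l < b) l + b)%N.
  by case: (b) => [|b']; [rewrite !big_geq | rewrite big_nat_recr].
rewrite [RHS]mulrCA; congr (_ * _).
  rewrite /bordered_det; apply: eq_det_sqmx => r l rv lv.
  rewrite [(l %/ _)%N]divn_small // [(l %% _)%N]modn_small //.
  case: (ltnP r v) => [rv'|_].
    by rewrite mulnS ltn_addr // divn_small // modn_small.
  by rewrite mulnS addnCA ltnNge leq_addl /= addnK.
rewrite mulnDr !exprD; set s1 := _ ^+ i; set s2 := _ ^+ (v * b)%N.
rewrite -(mulrA s1) [RHS]mulrCA; congr (_ * _).
rewrite -mulrA mulrCA; congr (_ * _).
(* Deleting a lower row and the first column block gives a matrix of the same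
   shape, for the rows [W (bump i r)] with column blocks renumbered. *)
rewrite -(IHb (fun r => W (bump i r) \o succn)).
apply: eq_det_sqmx => r c rb cb.
have -> : (v + c.+1 = v.+1 + c)%N by rewrite addSnnS.
rewrite [((v.+1 + c) %/ _)%N]divnDl // divnn [((v.+1 + c) %% _)%N]modnDl add1n.
case: (ltnP r (v * b)) => rvb.
  have v0 : (0 < v)%N by case: v rvb {IHb Nb rb cb s2}.
  have -> : bump (i + v * b) r = r by rewrite /bump; lia.
  rewrite mulnS ltn_add2l rvb.
  by rewrite divnDl // divnn v0 modnDl add1n eqSS.
have -> : bump (i + v * b) r = (v * b + bump i (r - v * b))%N.
  by rewrite /bump; lia.
by rewrite addnA -mulnS ltnNge leq_addr /= addKn.
Qed.

(** * From recursive subresultant matrices to subresultant matrices *)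

Lemma mxnth_ord (R : idomainType) (a b : nat) (M : 'M[R]_(a, b)) (r : 'I_a)
    (c : 'I_b) :
  mxnth M r c = M r c.
Proof. by rewrite /mxnth !valK. Qed.

Lemma mxnth_matrix (R : idomainType) (a b : nat) (f : nat -> nat -> R) (r c : nat) :
  (r < a)%N -> (c < b)%N -> mxnth (\matrix_(i < a, l < b) f i l) r c = f r c.
Proof.
by move=> ra cb; rewrite -[r]/(val (Ordinal ra)) -[c]/(val (Ordinal cb)) mxnth_ord mxE.
Qed.

Lemma mxnth_row_out (R : idomainType) (a b : nat) (M : 'M[R]_(a, b)) (r c : nat) :
  (a <= r)%N -> mxnth M r c = 0.
Proof. by move=> ar; rewrite /mxnth insubF // ltnNge ar. Qed.

Lemma select_mxE (R : idomainType) (C j : nat) (M : 'M[R]_(C + j, C)) (tau : nat) :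
  select_mx M tau =
  sqmx C (fun i l => mxnth M (if (i < C.-1)%N then i else (C + j - tau).-1) l).
Proof. by apply/matrixP=> i l; rewrite !mxE. Qed.

Lemma bordered_det_lower (R : idomainType) (v d x : nat)
    (M : 'M[R]_(v.+1 + d, v.+1)) :
  (x <= d)%N ->
  bordered_det v (mxnth M) (mxnth (lower_mx M) x) = (minor_poly M)`_(d - x).
Proof.
move=> xd; rewrite coef_poly ltnS leq_subr select_mxE; apply: eq_det_sqmx => r l rv lv.
case: ifP => // _; rewrite (@mxnth_matrix _ _ _ (fun r c => mxnth M (v + r) c)) //.
by congr mxnth; lia.
Qed.

(** The factor [d - x] on row [x] is the exponent by which differentiation
multiplies the coefficient of degree [d - x]. *)
Lemma bordered_det_lower_deriv (R : idomainType) (v d x : nat)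
    (M : 'M[R]_(v.+1 + d, v.+1)) :
  (x < d)%N ->
  bordered_det v (mxnth M) (mxnth (lower_deriv_mx M) x)
  = ((minor_poly M)^`())`_(d.-1 - x).
Proof.
move=> xd; rewrite coef_deriv (_ : (d.-1 - x).+1 = d - x)%N; last by lia.
rewrite -bordered_det_lower 1?ltnW // /bordered_det -[RHS]mulr_natl.
rewrite !(expand_det_row _ ord_max) big_distrr; apply: eq_bigr => l _.
rewrite !mxE /= ltnn (@mxnth_matrix _ _ _ (fun r c => mxnth (lower_mx M) r c *+ (d - r))) //.
rewrite -[X in X * _ = _]mulr_natl -[LHS]mulrA /cofactor; congr (_ * (_ * (_ * \det _))).
apply/matrixP=> r c; rewrite !mxE /= /bump.
have rv : (r < v)%N := ltn_ord r.
by rewrite (leqNgt v r) rv /= add0n rv.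
Qed.

Lemma bordered_det_shifted_lower (R : idomainType) (v d c s : nat)
    (M : 'M[R]_(v.+1 + d, v.+1)) :
  bordered_det v (mxnth M) (shifted_entry (lower_mx M) c s)
  = shifted_coef d (minor_poly M) c s.
Proof.
rewrite /shifted_coef; case: ifP => [/andP[cs sd]|out].
  rewrite (_ : d + c - s = d - (s - c))%N; last by lia.
  rewrite -bordered_det_lower; last by lia.
  by rewrite /shifted_entry cs.
apply: bordered_det0 => l lv; rewrite /shifted_entry; case: ifP => // cs.
by rewrite mxnth_row_out //; lia.
Qed.

Lemma bordered_det_shifted_lower_deriv (R : idomainType) (v d c s : nat)
    (M : 'M[R]_(v.+1 + d, v.+1)) :
  (0 < d)%N ->
  bordered_det v (mxnth M) (shifted_entry (lower_deriv_mx M) c s)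
  = shifted_coef d.-1 (minor_poly M)^`() c s.
Proof.
move=> d0; rewrite /shifted_coef; case: ifP => [/andP[cs sd]|out].
  rewrite (_ : d.-1 + c - s = d.-1 - (s - c))%N; last by lia.
  rewrite -bordered_det_lower_deriv; last by lia.
  by rewrite /shifted_entry cs.
apply: bordered_det0 => l lv; rewrite /shifted_entry; case: ifP => // cs.
by rewrite mxnth_row_out //; lia.
Qed.

(** The first [d - j - 1] column blocks shift the rows of [lower_mx M], hence the
coefficients of [minor_poly M], and the others those of its derivative; a lower
row shifted out of its block is zero, just as a coefficient out of range. *)
Lemma minor_poly_recursive_step (R : idomainType) (v d j : nat)
    (M : 'M[R]_(v.+1 + d, v.+1)) :
  (j < d)%N ->
  minor_poly (recursive_step j ((2 * d - 2 * j - 1) * v.+1) M) =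
  (-1) ^+ (v * \sum_(1 <= i < 2 * d - 2 * j - 1) i)
    *: minor_poly (subres_mx d d.-1 j (minor_poly M) (minor_poly M)^`()).
Proof.
move=> jd; set b := (2 * d - 2 * j - 1)%N; set e := (d - j - 1)%N.
have b0 : (0 < b)%N by rewrite /b; lia.
set S := minor_poly M.
apply/polyP=> tau; rewrite coefZ !coef_poly; case: ifP => [tj|_]; last by rewrite mulr0.
(* The rows of the lower block that [select_mx] keeps, counted from its top. *)
pose row s := if (s < b.-1)%N then s else (b + j - tau).-1.
pose W s c := if (c < e)%N then shifted_entry (lower_mx M) c (row s)
              else shifted_entry (lower_deriv_mx M) (c - e) (row s).
rewrite !select_mxE.
transitivity (\det (sqmx (b * v.+1) (fun r c =>
     if (r < v * b)%N
     then if (r %/ v == c %/ v.+1)%N then mxnth M (r %% v)%N (c %% v.+1)%N else 0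
     else W (r - v * b)%N (c %/ v.+1)%N (c %% v.+1)%N))).
  apply: eq_det_sqmx => r c rb cb.
  have Eb : (b * v.+1 = v * b + b)%N by rewrite mulnS addnC mulnC.
  set r' := if _ then _ else _.
  have r'b : (r' < b * v.+1 + j)%N by rewrite /r'; case: ifP; lia.
  rewrite (@mxnth_matrix R _ _ (fun r c =>
    if (r < v * b)%N then
      if (r %/ v == c %/ v.+1)%N
      then mxnth (upper_mx M) (r %% v) (c %% v.+1) else 0
    else if (c %/ v.+1 < e)%N
    then shifted_entry (lower_mx M) (c %/ v.+1) (r - v * b) (c %% v.+1)
    else shifted_entry (lower_deriv_mx M) (c %/ v.+1 - e) (r - v * b) (c %% v.+1)))
    //.
  have -> : (r' < v * b)%N = (r < v * b)%N by rewrite /r'; case: ifP; lia.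
  case: ifP => rvb.
    have -> : r' = r by rewrite /r'; case: ifP; lia.
    rewrite (@mxnth_matrix R v v.+1) ?ltn_mod //.
    by move: rvb; case: (v).
  rewrite (_ : r' - v * b = row (r - v * b))%N; last first.
    by rewrite /r' /row; case: ifP; case: ifP; lia.
  by rewrite /W; case: ifP.
rewrite det_diag_blocks; congr (_ * _).
have Cb : (d + d.-1 - 2 * j = b)%N by rewrite /b; lia.
transitivity (\det (sqmx (d + d.-1 - 2 * j) (fun s c =>
    if (c < e)%N then shifted_coef d S c (row s)
    else shifted_coef d.-1 S^`() (c - e) (row s)))).
  rewrite Cb; apply: eq_det_sqmx => s c sb cb; rewrite /W.
  case: ifP => _; first exact: bordered_det_shifted_lower.
  by apply: bordered_det_shifted_lower_deriv; lia.
apply: eq_det_sqmx => s c sb cb.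
have -> : (if (s < (d + d.-1 - 2 * j).-1)%N then s
           else (d + d.-1 - 2 * j + j - tau).-1) = row s by rewrite Cb.
rewrite (@mxnth_matrix R _ _ (fun r c =>
  if (c < d.-1 - j)%N then shifted_coef d S c r
  else shifted_coef d.-1 S^`() (c - (d.-1 - j)) r)) //; last first.
  by rewrite /row; move: sb; rewrite Cb; case: ifP; lia.
by rewrite (_ : d.-1 - j = e)%N // /e; lia.
Qed.

(** * Comparison of the two recurrences *)

Lemma minor_poly_subres_scale (R : idomainType) (p q j : nat) (a : R)
    (A B : {poly R}) :
  minor_poly (subres_mx p q j (a *: A) (a *: B)) =
  a ^+ (p + q - 2 * j) *: minor_poly (subres_mx p q j A B).
Proof.
apply/polyP=> tau; rewrite coefZ !coef_poly; case: ifP => [_|_]; last by rewrite mulr0.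
rewrite -detZ; congr (\det _); apply/matrixP=> s c; rewrite !mxE /mxnth.
case: insubP => [r _ _|_]; last by rewrite mulr0.
case: insubP => [l _ _|_]; last by rewrite mulr0.
by rewrite !mxE /shifted_coef; do 2 case: ifP => _; rewrite ?coefZ ?mulr0.
Qed.

Lemma ucolsS (m n : nat) (J : nat -> nat) (k j : nat) :
  ucols m n J k.+2 j = ((2 * J k.+1 - 2 * j - 1) * ucols m n J k.+1 (J k.+1))%N.
Proof.
case: k => [|k]; first by rewrite /= big_geq // muln1 mulnC.
by rewrite [LHS]/= big_nat_recr //= mulnC; congr muln; rewrite mulnA.
Qed.

Lemma ucols_gt0 (m n : nat) (J : nat -> nat) (k : nat) :
  (J 1 <= n)%N -> (n < m)%N ->
  (forall l, (0 < l <= k)%N -> (J l.+1 < J l)%N) ->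
  (0 < ucols m n J k.+1 (J k.+1))%N.
Proof.
move=> J1n nm; elim: k => [|k IHk] Jdec; first by rewrite /=; lia.
rewrite ucolsS muln_gt0 IHk ?andbT => [|l lk]; last by apply: Jdec; lia.
by have := Jdec k.+1; lia.
Qed.

Lemma recursive_subresS (R : idomainType) (m n : nat) (J : nat -> nat)
    (F G : {poly R}) (k j : nat) :
  (0 < ucols m n J k.+1 (J k.+1))%N -> (j < J k.+1)%N ->
  let S := recursive_subres m n J F G k.+1 (J k.+1) in
  recursive_subres m n J F G k.+2 j =
  rsign R m n J k.+2 j *: minor_poly (subres_mx (J k.+1) (J k.+1).-1 j S S^`()).
Proof.
move=> u0 jJ; rewrite /rsign /bexp /recursive_subres.
rewrite -[k.+2.-1]/k.+1 -[k.+1.-1]/k.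
set M := recursive_subres_mxS m n J F G k (J k.+1).
rewrite -[LHS]/(minor_poly (recursive_step j (ucols m n J k.+2 j) M)) ucolsS.
move: M u0; case: (ucols m n J k.+1 (J k.+1)) => // v M _ /=.
by rewrite minor_poly_recursive_step // (subn1 v.+1).
Qed.

(** Being a sign, [rsign] may be moved to the other side of
[recursive_subresS]. *)
Lemma rsign_sqr (R : idomainType) (m n : nat) (J : nat -> nat) (k j : nat) :
  rsign R m n J k j * rsign R m n J k j = 1.
Proof.
case: k => [|[|k]]; rewrite /rsign ?mulr1 //.
by rewrite -expr2 sqrr_sign.
Qed.

(** With [a] the coefficient [Rcoef] of one level and [j] the last degree of the
next, the new coefficient is [Rcoef] of the next level. *)
Lemma nested_recursive_subresS (R : idomainType) (m n : nat) (J : nat -> nat)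
    (F G : {poly R}) (k j : nat) (a : R) :
  (0 < ucols m n J k.+1 (J k.+1))%N -> (j < J k.+1)%N ->
  nested_subres m n J F G k.+1 (J k.+1) =
    a *: recursive_subres m n J F G k.+1 (J k.+1) ->
  nested_subres m n J F G k.+2 j =
  (a ^+ bexp J k.+2 j * rsign R m n J k.+2 j) *: recursive_subres m n J F G k.+2 j.
Proof.
move=> u0 jJ Ea; rewrite recursive_subresS // scalerA -mulrA rsign_sqr mulr1.
set S := nested_subres m n J F G k.+1 (J k.+1) in Ea.
rewrite -[LHS]/(minor_poly (subres_mx (J k.+1) (J k.+1).-1 j S S^`())) Ea.
rewrite derivZ minor_poly_subres_scale /bexp; congr (_ ^+ _ *: _).
by rewrite /=; lia.
Qed.

Lemma nested_recursive_subres (R : idomainType) (m n : nat) (J : nat -> nat)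
    (F G : {poly R}) (k j : nat) :
  (J 1 <= n)%N -> (n < m)%N ->
  (forall l, (0 < l <= k)%N -> (J l.+1 < J l)%N) ->
  (j < J k.+1)%N ->
  nested_subres m n J F G k.+2 j =
  (Rcoef R m n J k.+1 ^+ bexp J k.+2 j * rsign R m n J k.+2 j)
    *: recursive_subres m n J F G k.+2 j.
Proof.
move=> J1n nm Jdec jJ; apply: nested_recursive_subresS => //; first exact: ucols_gt0.
elim: k Jdec {j jJ} => [|k IHk] Jdec; first by rewrite scale1r.
have Jdec' l : (0 < l <= k)%N -> (J l.+1 < J l)%N by move=> lk; apply: Jdec; lia.
apply: nested_recursive_subresS (IHk Jdec'); first exact: ucols_gt0.
by apply: Jdec; rewrite /= leqnn.
Qed.

Lemma size_prs_last (R : idomainType) (F G : {poly R}) (s : seq {poly R}) :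
  is_prs F G s ->
  last 0 s != 0 /\ (size (last 0%R s) <= size G < size F)%N.
Proof.
move=> [[s1 s0] [sF sG] _ sdec]; split.
  by case: s s1 s0 {sF sG sdec} => //= p s _ s0; apply: s0; exact: mem_last.
rewrite -sF -sG sdec // andbT.
have mono i : (i.+1 < size s)%N -> (size (nth 0%R s i.+1) <= size (nth 0%R s 1))%N.
  elim: i => // i IHi lt_i; apply: leq_trans (IHi (ltnW lt_i)); apply: ltnW; exact: sdec.
rewrite -nth_last; case: (size s) s1 mono => [|[|N]] //= _ mono; exact: mono.
Qed.

Theorem theorem1 (R : idomainType) (F G : {poly R}) (m n : nat)
    (P : seq (seq {poly R})) (hF : size F = m.+1) (hG : size G = n.+1)
    (hn : (0 < n)%N) (hnm : (n < m)%N)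
    (hP : is_recursive_prs F G P) (hcomplete : rprs_complete P)
    (k j : nat) (hk : (1 < k <= size P)%N)
    (hj : (j + 2 <= rprs_deg m P k.-1)%N) :
  nested_subres m n (rprs_deg m P) F G k j =
  (Rcoef R m n (rprs_deg m P) k.-1 ^+ bexp (rprs_deg m P) k j
     * rsign R m n (rprs_deg m P) k j)
    *: recursive_subres m n (rprs_deg m P) F G k j.
Proof.
case: hP => _ [_ P1G] Pchain Pprs.
case: k hk hj => [|[|k]] //; rewrite -[k.+2.-1]/k.+1 => kP hj.
apply: nested_recursive_subres => //; last by move: hj; rewrite addn2 => /ltnW.
  have [|/size_prs_last[_ le1] _] := Pprs 1%N; first by lia.
  by move: le1; rewrite P1G hG /rprs_deg /rprs_last; lia.
move=> l /andP[l0 lk]; have [|prs_l _] := Pprs l.+1; first by lia.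
have [] := size_prs_last _ _ _ _ prs_l; have [|-> _] := Pchain l.+1; first by lia.
rewrite -size_poly_gt0 -/(rprs_last P l.+1); case: l l0 {prs_l lk} => // l _ last0.
by move=> /andP[/leq_ltn_trans le1 /le1 lt1]; move: last0 lt1; rewrite /=; lia.
Qed.
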